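(* Let $\mathcal{H}$ be a real Hilbert space, let $\alpha>0$, $\beta>0$, $\rho\in\,]0,\alpha^{-1}]$, let $f\in\mathscr{C}^{1,1}_{1/\alpha}(\mathcal{H})$ be $\rho$-strongly convex, and let $g\in\mathscr{C}^{1,1}_{1/\beta}(\mathcal{H})$ be convex. Assume that $f+g$ has a minimizer over $\mathcal{H}$. Let $\tau>0$. Then the following hold. 1. Suppose that $\tau\in\,]0,2\beta\alpha/(\beta+\alpha)[$. Then $G_{\tau(\nabla g+\nabla f)}$ is $r_G(\tau)$-Lipschitz continuous, where $$r_G(\tau):=\max\big\{|1-\tau\rho|,\,|1-\tau(\beta^{-1}+\alpha^{-1})|\big\}\in\,]0,1[.$$ In particular, the minimum of $r_G$ over $]0,2\beta\alpha/(\beta+\alpha)[$ is achieved at $$\tau^*=\frac{2}{\rho+\alpha^{-1}+\beta^{-1}}\quad\text{and}\quad r_G(\tau^* )=\frac{\alpha^{-1}+\beta^{-1}-\rho}{\alpha^{-1}+\beta^{-1}+\rho}.$$ 2. Suppose that $\tau\in\,]0,2\alpha[$. Then $T_{\tau\nabla g,\tau\nabla f}$ is $r_{T_1}(\tau)$-Lipschitz continuous, where $$r_{T_1}(\tau):=\max\big\{|1-\tau\rho|,\,|1-\tau\alpha^{-1}|\big\}\in\,]0,1[.$$ In particular, the minimum of $r_{T_1}$ over $]0,2\alpha[$ is achieved at $$\tau^*=\frac{2}{\rho+\alpha^{-1}}\quad\text{and}\quad r_{T_1}(\tau^* )=\frac{\alpha^{-1}-\rho}{\alpha^{-1}+\rho}.$$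 3. Suppose that $\tau\in\,]0,2\beta]$. Then $T_{\tau\nabla f,\tau\nabla g}$ is $r_{T_2}(\tau)$-Lipschitz continuous, where $$r_{T_2}(\tau):=\frac{1}{1+\tau\rho}\in\,]0,1[.$$ In particular, the minimum of $r_{T_2}$ over $]0,2\beta]$ is achieved at $\tau^*=2\beta$ and $r_{T_2}(\tau^* )=\frac{1}{1+2\beta\rho}$. 4. $R_{\tau\nabla g,\tau\nabla f}$ and $R_{\tau\nabla f,\tau\nabla g}$ are $r_R(\tau)$-Lipschitz continuous, where $$r_R(\tau)=\max\left\{\frac{1-\tau\rho}{1+\tau\rho},\ \frac{\tau\alpha^{-1}-1}{\tau\alpha^{-1}+1}\right\}\in\,]0,1[.$$ In particular, the minimum of $r_R$ over $]0,+\infty[$ is achieved at $\tau^*=\sqrt{\alpha/\rho}$ and $r_R(\tau^* )=\frac{1-\sqrt{\alpha\rho}}{1+\sqrt{\alpha\rho}}$. 5. $S_{\tau\nabla g,\tau\nabla f}$ and $S_{\tau\nabla f,\tau\nabla g}$ are $r_S(\tau)$-Lipschitz continuous, where $$r_S(\tau)=\min\left\{\frac{1+r_R(\tau)}{2},\ \frac{\beta+\tau^2\rho}{\beta+\tau\beta\rho+\tau^2\rho}\right\}\in\,]0,1[$$ and $r_R$ is defined in item 4. In particular, the optimal step-size (a minimizer of $r_S$ over $]0,+\infty[$) and the minimum of $r_S$ are $$(\tau^*,r_S(\tau^* ))=\begin{cases}\left(\sqrt{\frac{\alpha}{\rho}},\ \frac{1}{1+\sqrt{\alpha\rho}}\right),&\text{if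 }\beta\le 4\alpha;\\[2mm] \left(\sqrt{\frac{\beta}{\rho}},\ \frac{2}{2+\sqrt{\beta\rho}}\right),&\text{otherwise.}\end{cases}$$
   Context: For $L\ge 0$, $\mathscr{C}^{1,1}_L(\mathcal{H})$ is the class of functions $h\colon\mathcal{H}\to\mathbb{R}$ that are Gâteaux differentiable on $\mathcal{H}$ (with gradient $\nabla h(x)\in\mathcal{H}$ the Riesz representative of the derivative at $x$) and such that $\nabla h\colon\mathcal{H}\to\mathcal{H}$ is $L$-Lipschitz continuous. A function $h\in\mathscr{C}^{1,1}_L(\mathcal{H})$ is $\rho$-strongly convex ($\rho>0$) if $h-\frac{\rho}{2}\|\cdot\|^2$ is convex. An operator $\Phi\colon\mathcal{H}\to\mathcal{H}$ is $\omega$-Lipschitz continuous ($\omega\ge 0$) if $\|\Phi x-\Phi y\|\le\omega\|x-y\|$ for all $x,y\in\mathcal{H}$. $\mathrm{Id}$ is the identity operator on $\mathcal{H}$. For a convex $h\in\mathscr{C}^{1,1}_L(\mathcal{H})$ and $\tau>0$, $\nabla h$ is maximally monotone, and $J_{\tau\nabla h}=(\mathrm{Id}+\tau\nabla h)^{-1}=\mathrm{prox}_{\tau h}$ is the single-valued, everywhere defined operator $x\mapsto\arg\min_{y\in\mathcal{H}}\big(\tau h(y)+\frac12\|y-x\|^2\big)$. For such gradient operators $\mathcal{M},\mathcal{N}\colon\mathcal{H}\to\mathcal{H}$ and $\tau>0$ define - $G_{\tau\mathcal{M}}=\mathrm{Id}-\tau\mathcal{M}$ (explicit/gradient operator); -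 $T_{\tau\mathcal{N},\tau\mathcal{M}}=J_{\tau\mathcal{N}}\circ G_{\tau\mathcal{M}}$ (forward-backward operator); - $R_{\tau\mathcal{N},\tau\mathcal{M}}=(2J_{\tau\mathcal{N}}-\mathrm{Id})\circ(2J_{\tau\mathcal{M}}-\mathrm{Id})$ (Peaceman-Rachford operator); - $S_{\tau\mathcal{N},\tau\mathcal{M}}=\frac{1}{2}\big(\mathrm{Id}+R_{\tau\mathcal{N},\tau\mathcal{M}}\big)$ (Douglas-Rachford operator).
   Formalization: In items 2 and 4 the claims r_{T_1}(τ), r_R(τ) ∈ ]0,1[ fail when ρ = 1/α and τ = α, where both rates equal 0; the formal statement says they lie in [0,1[ and vanish exactly in that case. *)

(* Defs.v *)
From HB Require Import structures.
From mathcomp Require Import all_boot all_order all_algebra sesquilinear.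
From mathcomp Require Import all_classical all_reals all_analysis.

Set Implicit Arguments.
Unset Strict Implicit.
Unset Printing Implicit Defensive.

Import Order.TTheory GRing.Theory Num.Theory.
Import numFieldNormedType.Exports.

Local Open Scope classical_set_scope.
Local Open Scope ring_scope.

(* A real Hilbert space is a complete normed module H together with a
   (symmetric, bilinear, positive definite) form inducing its norm. *)
Definition inner_product (R : realType) (H : completeNormedModType R)
    (dot : {dot H for (@idfun R)}) : Prop :=
  forall x : H, dot x x = `|x| ^+ 2.

Definition gateaux_differentiable (R : realType) (H : normedModType R)
    (h : H -> R) (x : H) : Prop :=
  [/\ forall v, derivable (h : H -> R^o) x v,
      linear (fun v => 'D_v (h : H -> R^o) x)
    & continuous (fun v => 'D_v (h : H -> R^o) x)].

(* Riesz representative of the Gateaux derivative of h at x; the default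
   value 0 is only used when there is no representative. *)
Definition grad (R : realType) (H : completeNormedModType R)
    (dot : {dot H for (@idfun R)}) (h : H -> R) (x : H) : H :=
  xget 0 [set u : H | forall v, 'D_v (h : H -> R^o) x = dot u v].

Definition C11 (R : realType) (H : completeNormedModType R)
    (dot : {dot H for (@idfun R)}) (L : R) (h : H -> R) : Prop :=
  (forall x, gateaux_differentiable h x) /\ L.-lipschitz (grad dot h).

Definition convex (R : realType) (H : normedModType R) (h : H -> R) : Prop :=
  @convex_function R H setT h.

Definition strongly_convex (R : realType) (H : normedModType R) (rho : R)
    (h : H -> R) : Prop :=
  convex (fun x => h x - rho / 2 * `|x| ^+ 2).

Definition minimizer_on (R : realType) (T : Type) (D : set T) (h : T -> R)
    (x : T) : Prop :=
  D x /\ forall y, D y -> h x <= h y.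

Section operators.
Context {R : realType} {H : normedModType R}.
Implicit Types A B : H -> H.

(* (Id + A)^-1; the default value 0 is only used when the equation
   y + A y = x has no solution y. *)
Definition resolvent A (x : H) : H := xget 0 [set y : H | y + A y = x].

Definition reflected_resolvent A (x : H) : H := 2 *: resolvent A x - x.

Definition explicit_op A (x : H) : H := x - A x.

Definition forward_backward B A : H -> H := resolvent B \o explicit_op A.

Definition peaceman_rachford B A : H -> H :=
  reflected_resolvent B \o reflected_resolvent A.

Definition douglas_rachford B A (x : H) : H :=
  2^-1 *: (x + peaceman_rachford B A x).

End operators.

Section rates.
Context {R : realType}.
Variables alpha beta rho : R.
Implicit Type tau : R.

Definition rG tau : R :=
  Num.max `|1 - tau * rho| `|1 - tau * (beta^-1 + alpha^-1)|.

Definition rT1 tau : R := Num.max `|1 - tau * rho| `|1 - tau * alpha^-1|.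

Definition rT2 tau : R := 1 / (1 + tau * rho).

Definition rR tau : R :=
  Num.max ((1 - tau * rho) / (1 + tau * rho))
          ((tau * alpha^-1 - 1) / (tau * alpha^-1 + 1)).

Definition rS tau : R :=
  Num.min ((1 + rR tau) / 2)
          ((beta + tau ^+ 2 * rho) / (beta + tau * beta * rho + tau ^+ 2 * rho)).

End rates.

(* Main.v *)
Require Import Defs.
From HB Require Import structures.
From mathcomp Require Import all_boot all_order all_algebra sesquilinear.
From mathcomp Require Import all_classical all_reals all_analysis.
From mathcomp Require Import ring lra.

(** For increments [p] of the variable and [q] of an operator [A], call [A] a
    sector operator with bounds [a <= b] when [0 <= <q - a p, b p - q>], i.e.
    when [q] lies in the ball centred at [(a + b) / 2 p] with radius
    [(b - a) / 2 |p|].  The ball form shows that sectors add up and that the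
    operator is [m]-Lipschitz as soon as [- m <= a] and [b <= m]; the product
    form shows that explicit steps, resolvents and reflected resolvents of
    sector operators are again sector operators, their bounds being
    transformed by [s |-> 1 - s], [1 / (1 + s)] and [(1 - s) / (1 + s)].  The
    Baillon-Haddad argument gives [grad f] the bounds [rho] and [1 / alpha]
    and [grad g] the bounds [0] and [1 / beta], whence the first four rates.
    The second Douglas-Rachford rate [1 / (1 + c)] comes from the identity
    [<x - S x, S x> = <A y, y> + <B z, z>] on increments, with
    [S x = z + A y = y - B z], whose right-hand side is at least
    [c |S x| ^ 2] by strong monotonicity of one operator and cocoercivity of
    the other. *)

Set Implicit Arguments.
Unset Strict Implicit.
Unset Printing Implicit Defensive.

Import Order.TTheory GRing.Theory Num.Theory.
Import numFieldNormedType.Exports.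

Local Open Scope classical_set_scope.
Local Open Scope ring_scope.

(** * Inner product calculus and the Riesz representation *)

Section dot_product.
Context {R : realType} {H : completeNormedModType R}.
Variable dot : {dot H for (@idfun R)}.
Implicit Types u v w : H.

Lemma dotC u v : dot u v = dot v u.
Proof. by rewrite hermC expr0 mul1r. Qed.

(* The casts keep the ring operations on the right-hand sides attached to [R]
   itself, so that [ring] and [lra] recognize them. *)
Lemma dotDl u v w : (dot (u + v) w : R) = (dot u w : R) + dot v w.
Proof. exact: linearDl. Qed.

Lemma dotNl u v : (dot (- u) v : R) = - (dot u v : R).
Proof. exact: linearNl. Qed.

Lemma dotZl (a : R) u v : (dot (a *: u) v : R) = a * (dot u v : R).
Proof. exact: linearZl_LR. Qed.

Lemma dotDr u v w : (dot u (v + w) : R) = (dot u v : R) + dot u w.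
Proof. exact: linearDr. Qed.

Lemma dotNr u v : (dot u (- v) : R) = - (dot u v : R).
Proof. exact: linearNr. Qed.

Lemma dotZr (a : R) u v : (dot u (a *: v) : R) = a * (dot u v : R).
Proof. exact: linearZr_LR. Qed.

Definition dotE := (dotDl, dotDr, dotNl, dotNr, dotZl, dotZr).

Hypothesis hdot : inner_product dot.

Lemma dot_ge0 u : 0 <= dot u u.
Proof. by rewrite hdot sqr_ge0. Qed.

(** Cauchy-Schwarz: expanding the squared norm of [|v|^2 u - <u, v> v] leaves [|v|^2] times the
    difference of the squares of the two sides. *)
Lemma dot_le u v : dot u v <= `|u| * `|v|.
Proof.
have [->|v0] := eqVneq v 0; first by rewrite linear0r normr0 mulr0.
have nv : 0 < `|v| by rewrite normr_gt0.
have := dot_ge0 (`|v| ^+ 2 *: u - dot u v *: v).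
rewrite !dotE (dotC v u) !hdot => h.
have : (dot u v) ^+ 2 <= (`|u| * `|v|) ^+ 2.
  rewrite -(ler_pM2l (exprn_gt0 2 nv)); nra.
have : 0 <= `|u| * `|v| by exact: mulr_ge0.
by nra.
Qed.

Lemma normsqD u v : `|u + v| ^+ 2 = `|u| ^+ 2 + 2 * dot u v + `|v| ^+ 2 :> R.
Proof. by rewrite -!hdot !dotE (dotC v u); ring. Qed.

(* Turns identities between vectors into ring identities between scalars. *)
Lemma dot_inj u v : (forall w, dot u w = dot v w) -> u = v.
Proof.
move=> uv; apply/eqP; rewrite -subr_eq0 -normr_eq0 -sqrf_eq0 -hdot.
by rewrite dotDl dotNl uv subrr.
Qed.

(* The representative is the minimizer of [|x| ^ 2 / 2 - phi x], whose
   minimizing sequences are Cauchy by the parallelogram law. *)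
Lemma Riesz_representation (phi : {linear H -> R^o}) :
  continuous phi -> exists u, forall v, phi v = dot u v.
Proof.
move=> cphi.
pose q (x : H) : R := `|x| ^+ 2 / 2 - phi x.
have cq : continuous q.
  move=> x; apply: cvgB; last exact: cphi.
  apply: cvgMl; apply: cvgM; exact: cvg_norm.
have phiZ a x : phi (a *: x) = a * phi x by rewrite linearZ.
have phiD x y : phi (x + y) = phi x + phi y by rewrite linearD.
have qmid x y : q x + q y - 2 * q (2^-1 *: (x + y)) = `|x - y| ^+ 2 / 4.
  rewrite /q -!hdot phiZ phiD /= !dotE (dotC y x).
  by move: (phi x : R) (phi y : R) => a b; field.
have [M phiM] : exists M, forall x, `|phi x| <= M * `|x|.
  have /linear_boundedP [M [_ hM]] := (linear_bounded_continuous phi).2 cphi.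
  exists (M + 1) => x; apply: (hM (M + 1)); rewrite ?ltrDl//.
have qlb x : - (M ^+ 2 / 2) <= q x.
  have := phiM x; rewrite /q ler_norml => /andP[_].
  have := sqr_ge0 (`|x| - M); nra.
have hinf : has_inf (range q).
  split; first by exists (q 0), 0.
  by exists (- (M ^+ 2 / 2)) => _ [x _ <-].
set m := inf (range q).
have qm x : m <= q x by apply: ge_inf; [exact: hinf.2|exists x].
have /choice[a am] : forall n : nat, exists x, q x < m + n.+1%:R^-1.
  move=> n.
  have n0 : 0 < n.+1%:R^-1 :> R by rewrite invr_gt0 ltr0n.
  have [_ [x _ <-] hx] := inf_adherent n0 hinf.
  by exists x.
have /cvg_ex[/= u au] : cvgn a.
  apply: cauchy_cvg; apply: cauchy_exP => e e0.
  (* By [qmid] and minimality of [m], [|a N - a n|^2 / 4] is less than [2 / (N + 1)] for [n >= N],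
     so [e^2 / 8] is the required accuracy. *)
  have [N hN] : exists N : nat, N.+1%:R^-1 < e ^+ 2 / 8.
    have e8 : 0 < e ^+ 2 / 8 by rewrite divr_gt0 ?exprn_gt0.
    exists (Num.truncn (e ^+ 2 / 8)^-1).
    by rewrite -ltf_pV2 ?(posrE, e8)// ?invr_gt0// invrK truncnS_gt.
  rewrite /fmapE -ball_normE /ball_.
  exists (a N), N => // n Nn /=.
  have nN : n.+1%:R^-1 <= N.+1%:R^-1 :> R by rewrite lef_pV2 ?posrE// ler_nat.
  rewrite -(ltr_pXn2r (n := 2)) ?nnegrE ?(ltW e0)//.
  move: (qmid (a N) (a n)) (qm (2^-1 *: (a N + a n))) (am N) (am n) hN nN.
  by move: (N.+1%:R^-1 : R) (n.+1%:R^-1 : R) => i j; lra.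
have qu : q u <= m.
  apply: (ler_cvg_to (f := q \o a) (g := fun n => m + n.+1%:R^-1) (a := \oo)).
  - exact: (cvg_comp _ _ au (cq u)).
  - rewrite -[X in _ --> X]addr0; apply: cvgD; [exact: cvg_cst|exact: cvg_harmonic].
  - by apply: nearW => n; exact/ltW/am.
exists u => v; apply/eqP; rewrite -subr_eq0; apply/negPn/negP => d0.
have qt t : 0 <= t * (dot u v - phi v) + t ^+ 2 / 2 * `|v| ^+ 2.
  have := le_trans qu (qm (u + t *: v)).
  rewrite /q -!hdot phiD phiZ /= !dotE (dotC v u).
  by move: (phi u : R) (phi v : R) => b c; lra.
have d2 : 0 < (phi v - dot u v) ^+ 2 by rewrite exprn_even_gt0.
have v2 : 0 < 1 + `|v| ^+ 2 by rewrite ltr_wpDr ?exprn_ge0.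
(* Near-optimal [t] for the quadratic in [qt], which becomes negative there; the added [1] keeps the
   denominator nonzero when [v = 0]. *)
have := qt ((phi v - dot u v) / (1 + `|v| ^+ 2)).
rewrite leNgt => /negP; apply.
set c := phi v - _ in d2 *.
rewrite (_ : dot u v - phi v = - c); last by rewrite opprB.
have -> : c / (1 + `|v| ^+ 2) * - c + (c / (1 + `|v| ^+ 2)) ^+ 2 / 2 * `|v| ^+ 2
  = - (c ^+ 2 * (2 + `|v| ^+ 2)) / (2 * (1 + `|v| ^+ 2) ^+ 2).
  by move: (c : R) (`|v| : R) v2 => b n n2; field; rewrite gt_eqF.
rewrite mulNr oppr_lt0 divr_gt0//.
  by rewrite mulr_gt0// (lt_le_trans v2)// lerD2r ler1n.
Qed.
End dot_product.

(** * Gradients: descent lemma, first-order convexity, Baillon-Haddad *)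

Section gradient.
Context {R : realType} {H : completeNormedModType R}.
Variable dot : {dot H for (@idfun R)}.
Hypothesis hdot : inner_product dot.
Implicit Types (h : H -> R) (x y v : H).

(** By Riesz a representative exists, so the default value in [grad] is never taken. *)
Lemma grad_dot h x v :
  gateaux_differentiable h x -> 'D_v (h : H -> R^o) x = dot (grad dot h x) v.
Proof.
case=> _ lin cont.
pose phi : {linear H -> R^o} := HB.pack (fun v => 'D_v (h : H -> R^o) x)
  (GRing.isLinear.Build R H R^o _ (fun v => 'D_v (h : H -> R^o) x) lin).
have [u hu] := Riesz_representation hdot (phi := phi) cont.
rewrite /grad; case: xgetP => [w _ hw|hno]; first exact: hw.
by case: (hno u).
Qed.

Lemma derive_along_line h x v (t : R) :
  derivable (h : H -> R^o) (x + t *: v) v ->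
  is_derive t (1 : R) (fun s => h (x + s *: v) : R) ('D_v (h : H -> R^o) (x + t *: v)).
Proof.
have E : (fun s : R => s^-1 *: (((fun s => h (x + s *: v)) \o shift t) (s *: 1)
             - h (x + t *: v))) =
         (fun s : R => s^-1 *: ((h \o shift (x + t *: v)) (s *: v)
             - h (x + t *: v))).
  by apply/funext => s /=; rewrite [s *: 1]mulr1 scalerDl addrCA.
move=> dh; apply: DeriveDef; first by rewrite /derivable E.
by rewrite /derive E.
Qed.

(** The mean value theorem for [f t - (a t + b t^2 / 2)] replaces integration of the derivative. Its
    intermediate point is interior to the unit interval, so a bound for positive [t] suffices. *)
Lemma le_of_derive_affine (f df : R -> R) (a b : R) :
  (forall t, is_derive t (1 : R) f (df t)) ->
  (forall t, 0 < t -> df t <= a + b * t) -> f 1 <= f 0 + a + b / 2.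
Proof.
move=> hf hdf.
pose g : R -> R := f - (a \*: id + (b / 2) \*: (id * id)).
have gE t : g t = f t - (a * t + b / 2 * (t * t)) by [].
have dg t : is_derive t (1 : R) g (df t - (a + b * t)).
  apply: is_derive_eq.
  by rewrite /GRing.scale /=; field.
have [|c /itvP c01] := MVT ltr01 (fun t _ => dg t).
  apply: derivable_within_continuous => t _.
  exact: (@ex_derive _ _ _ _ _ _ _ (dg t)).
have := hdf c; rewrite c01 => /(_ isT).
rewrite !gE; lra.
Qed.

(** Along [x + t v], Cauchy-Schwarz and the Lipschitz gradient keep the derivative within
    [L |v|^2 t] of its value at [0]; the mean value bound applied to [h] and to [- h] gives the two
    sides. *)
Lemma descent h L x v : C11 dot L h ->
  `|h (x + v) - h x - dot (grad dot h x) v| <= L / 2 * `|v| ^+ 2.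
Proof.
case=> dh lip.
have line t : is_derive t (1 : R) (fun s => h (x + s *: v) : R)
    (dot (grad dot h (x + t *: v)) v).
  by rewrite -grad_dot//; apply: derive_along_line; case: (dh (x + t *: v)).
have bnd t : 0 < t ->
    dot (grad dot h (x + t *: v)) v <= dot (grad dot h x) v + L * `|v| ^+ 2 * t
 /\ - dot (grad dot h (x + t *: v)) v <=
    - dot (grad dot h x) v + L * `|v| ^+ 2 * t.
  move=> t0.
  have /= := lip (x + t *: v, x) (conj I I).
  rewrite [x + _ - x]addrAC subrr add0r normrZ gtr0_norm//.
  move: (grad dot h (x + t *: v)) (grad dot h x) => p q pq.
  have {}pq : `|p - q| * `|v| <= L * `|v| ^+ 2 * t.
    have := ler_wpM2r (normr_ge0 v) pq.
    by rewrite (_ : _ * _ * `|v| = L * `|v| ^+ 2 * t)//; ring.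
  have := le_trans (dot_le hdot (p - q) v) pq.
  have := dot_le hdot (- (p - q)) v; rewrite normrN => /le_trans/(_ pq).
  by rewrite !dotNl dotDl dotNl; move: (L * _ * _) => c; split; lra.
have lineN t : is_derive t (1 : R) (fun s => - h (x + s *: v) : R)
    (- dot (grad dot h (x + t *: v)) v) by apply: is_deriveN.
have /= := le_of_derive_affine (a := dot (grad dot h x) v)
  (b := L * `|v| ^+ 2) line.
have /= := le_of_derive_affine (a := - dot (grad dot h x) v)
  (b := L * `|v| ^+ 2) lineN.
rewrite scale0r scale1r addr0 => lower upper.
rewrite ler_norml; apply/andP; split.
  have /lower := fun t t0 => (bnd t t0).2.
  by move: (h x) (h (x + v)) (dot _ v) (`|v| ^+ 2) => a b c d; lra.
have /upper := fun t t0 => (bnd t t0).1.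
by move: (h x) (h (x + v)) (dot _ v) (`|v| ^+ 2) => a b c d; lra.
Qed.

Lemma strongly_convexP rho h x y (t : R) : strongly_convex rho h -> 0 <= t <= 1 ->
  h (t *: x + (1 - t) *: y) - rho / 2 * `|t *: x + (1 - t) *: y| ^+ 2 <=
  t * (h x - rho / 2 * `|x| ^+ 2) + (1 - t) * (h y - rho / 2 * `|y| ^+ 2).
Proof.
move=> sc /andP[t0 t1].
by have := sc (Itv01 t0 t1) x y (in_setT _) (in_setT _).
Qed.

(** The convexity inequality at [x + t (y - x)], combined with the lower descent bound, shows that
    the gap [Q] is at most [t C] for all small [t], hence nonpositive. *)
Lemma strongly_convex_grad L rho h x y :
  C11 dot L h -> strongly_convex rho h ->
  h x - rho / 2 * `|x| ^+ 2 + dot (grad dot h x - rho *: x) (y - x) <=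
  h y - rho / 2 * `|y| ^+ 2.
Proof.
move=> hC sc; set k := fun x : H => h x - rho / 2 * `|x| ^+ 2.
set Q := k x + dot (grad dot h x - rho *: x) (y - x) - k y.
set C := (L + rho) / 2 * `|y - x| ^+ 2.
rewrite -subr_le0 -[leLHS]/Q.
have QC t : 0 < t -> t <= 1 -> Q <= t * C.
  move=> t0 t1; rewrite -(ler_pM2l t0).
  have := strongly_convexP y x sc (t := t); rewrite (ltW t0) t1 => /(_ isT).
  have -> : t *: y + (1 - t) *: x = x + t *: (y - x).
    by apply: (dot_inj hdot) => w; rewrite !dotE; ring.
  have := descent x (t *: (y - x)) hC; rewrite ler_norml => /andP[+ _].
  rewrite (normsqD hdot) normrZ exprMn real_normK ?num_real// !dotZr.
  rewrite /Q /C /k dotDl dotNl dotZl; move: (y - x) => v.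
  move: (h x) (h y) (h _) (`|x| ^+ 2) (`|y| ^+ 2) (`|v| ^+ 2) (dot _ _) (dot _ _).
  move=> a b c d e f g i; lra.
rewrite leNgt; apply/negP => Q0.
have D0 : 0 < Q + `|C| + 1 by rewrite ltr_wpDl// addr_ge0// ltW.
(* For this [t] the bound reads [Q + |C| + 1 <= C], which is absurd. *)
have := QC (Q / (Q + `|C| + 1)); rewrite divr_gt0// ler_pdivrMr// mul1r.
rewrite -addrA lerDl addr_ge0// => /(_ isT isT).
rewrite addrA mulrAC ler_pdivlMr// ler_pM2l//.
by have := ler_norm C; lra.
Qed.

(* Compare the two bounds at the gradient steps [y + s e] and [x - s e], where
   [e = u x - u y]. *)
Lemma cocoercive_of_quadratic_bounds (k : H -> R) (u : H -> H) (M : R) x y : 0 <= M ->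
  (forall x y, k x + dot (u x) (y - x) <= k y) ->
  (forall x y, k y <= k x + dot (u x) (y - x) + M / 2 * `|y - x| ^+ 2) ->
  0 <= dot (u x - u y) (M *: (x - y) - (u x - u y)).
Proof.
move=> M0 lower upper; set e := u x - u y.
rewrite dotDr dotNr dotZr.
set X := dot e (x - y); set E := dot e e.
have E0 : 0 <= E by exact: dot_ge0.
have sX s : (2 * s - M * s ^+ 2) * E <= X.
  have := le_trans (lower x (y + s *: e)) (upper y (y + s *: e)).
  have := le_trans (lower y (x - s *: e)) (upper x (x - s *: e)).
  rewrite [y + _ - y]addrAC [x - _ - x]addrAC !subrr !add0r -!hdot !dotE -/E.
  have -> : E = dot (u x) e - dot (u y) e by rewrite /E dotDl dotNl.
  rewrite /X /e !dotE.
  move: (dot (u x) x) (dot (u x) y) (dot (u y) x) (dot (u y) y) => a b c d.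
  move: (dot (u x) (u x)) (dot (u x) (u y)) (dot (u y) (u x)) (dot (u y) (u y)).
  by move=> p q r w; move: (k x) (k y) => i j; lra.
have [Mpos|Mle] := ltP 0 M.
  (* [s = 1 / M] maximizes [2 s - M s^2]. *)
  have := sX M^-1.
  rewrite (_ : 2 * M^-1 - M * M^-1 ^+ 2 = M^-1); last by field; rewrite gt_eqF.
  by rewrite ler_pdivrMl// subr_ge0.
have M00 : M = 0 by apply/eqP; rewrite eq_le Mle.
rewrite M00 mul0r sub0r oppr_ge0 leNgt; apply/negP => Epos.
(* For [M = 0] the left side [2 s E] is unbounded in [s] if [E > 0]; this [s] gives [X + 1 <= X]. *)
have := sX ((X + 1) / (2 * E)).
rewrite M00 mul0r subr0 (_ : 2 * _ * E = X + 1).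
  by rewrite gerDl ler10.
by field; rewrite gt_eqF.
Qed.

(** Free of division, so the degenerate case [a = b] is covered: it forces
    [A x - A y = a (x - y)]. *)
Definition sector (a b : R) (A : H -> H) := forall x y,
  0 <= dot (A x - A y - a *: (x - y)) (b *: (x - y) - (A x - A y)).

(** Subtracting [rho / 2 |x|^2] shifts the gradient by [rho x]; the shifted function satisfies both
    quadratic bounds with [M = L - rho], and its cocoercivity is the sector inequality. *)
Lemma sector_grad L rho h : rho <= L -> C11 dot L h -> strongly_convex rho h ->
  sector rho L (grad dot h).
Proof.
move=> rhoL hC sc x y.
have := @cocoercive_of_quadratic_bounds (fun x => h x - rho / 2 * `|x| ^+ 2)
  (fun x => grad dot h x - rho *: x) (L - rho) x y.
rewrite subr_ge0 => /(_ rhoL) H1.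
have lowerE (p q u v : H) :
  p - q - rho *: (u - v) = p - rho *: u - (q - rho *: v).
  by apply: (dot_inj hdot) => w; rewrite !dotE; ring.
have upperE (p q u v : H) : L *: (u - v) - (p - q) =
    (L - rho) *: (u - v) - (p - rho *: u - (q - rho *: v)).
  by apply: (dot_inj hdot) => w; rewrite !dotE; ring.
rewrite lowerE upperE.
apply: H1 => {}x {}y; first exact: (strongly_convex_grad _ _ hC).
have := descent x (y - x) hC; rewrite subrKC => /ler_normlW.
have -> : `|y| ^+ 2 = `|x| ^+ 2 + 2 * dot x (y - x) + `|y - x| ^+ 2.
  by rewrite -(normsqD hdot) subrKC.
rewrite dotDl dotNl dotZl.
move: (h x) (h y) (dot _ _) (dot _ _) (`|x| ^+ 2) (`|y - x| ^+ 2).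
by move=> a b c d e f; lra.
Qed.

End gradient.

(** * Calculus of sector operators, resolvents and Douglas-Rachford steps *)

Section sector_operators.
Context {R : realType} {H : completeNormedModType R}.
Variable dot : {dot H for (@idfun R)}.
Hypothesis hdot : inner_product dot.
Implicit Types (A B : H -> H) (x y : H) (a b c m : R).

Lemma lipschitzP m A :
  m.-lipschitz A <-> forall x y, `|A x - A y| <= m * `|x - y|.
Proof.
split=> [hA x y|hA [x y] _]; last exact: hA.
exact: (hA (x, y) (conj I I)).
Qed.

Lemma lipschitz_comp a b A B : 0 <= a -> a.-lipschitz A -> b.-lipschitz B ->
  (a * b).-lipschitz (A \o B).
Proof.
move=> a0 /lipschitzP hA /lipschitzP hB; apply/lipschitzP => x y /=.
by rewrite (le_trans (hA _ _))// -mulrA ler_wpM2l.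
Qed.

Lemma douglas_rachford_average m A B : m.-lipschitz (peaceman_rachford B A) ->
  ((1 + m) / 2).-lipschitz (douglas_rachford B A).
Proof.
move=> /lipschitzP hA; apply/lipschitzP => x y; have := hA x y.
rewrite /douglas_rachford; move: (peaceman_rachford B A x) => p.
move: (peaceman_rachford B A y) => q pq.
rewrite -scalerBr normrZ ger0_norm ?invr_ge0// mulrC mulrAC ler_wpM2r ?invr_ge0//.
by rewrite opprD addrACA (le_trans (ler_normD _ _))// mulrDl mul1r lerD2l.
Qed.

Lemma sector_normE a b x y : `|y - ((a + b) / 2) *: x| ^+ 2 =
  ((b - a) / 2 * `|x|) ^+ 2 - dot (y - a *: x) (b *: x - y).
Proof.
rewrite exprMn -!hdot !dotE (dotC dot y x).
by move: (dot x x) (dot x y) (dot y y) => p q r; field.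
Qed.

Lemma sector_ball a b x y : a <= b ->
  (0 <= dot (y - a *: x) (b *: x - y)) =
  (`|y - ((a + b) / 2) *: x| <= (b - a) / 2 * `|x|).
Proof.
move=> ab; rewrite -[RHS](ler_pXn2r (n := 2)) ?nnegrE//.
  by rewrite sector_normE gerBl.
by rewrite mulr_ge0// divr_ge0// subr_ge0.
Qed.

(** Triangle inequality through the centre of the ball: [|(a + b) / 2| + (b - a) / 2] is the maximum
    of [- a] and [b]. *)
Lemma sector_lipschitz a b m A : a <= b -> - m <= a -> b <= m ->
  sector dot a b A -> m.-lipschitz A.
Proof.
move=> ab ma bm sA; apply/lipschitzP => x y.
have := sA x y; rewrite sector_ball//.
move: (A x - A y) (x - y) => q p hq.
rewrite -[q](subrK (((a + b) / 2) *: p)) (le_trans (ler_normD _ _))//.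
rewrite (le_trans (lerD hq (lexx _)))// normrZ -mulrDl ler_wpM2r//.
by case: (ler0P ((a + b) / 2)) => _; lra.
Qed.

Lemma sectorD a b c d A B : a <= b -> c <= d ->
  sector dot a b A -> sector dot c d B -> sector dot (a + c) (b + d) (A \+ B).
Proof.
move=> ab cd sA sB x y; have := sB x y; have := sA x y.
rewrite !sector_ball ?lerD//= => hA hB.
have -> : A x + B x - (A y + B y) - ((a + c + (b + d)) / 2) *: (x - y) =
  (A x - A y - ((a + b) / 2) *: (x - y)) + (B x - B y - ((c + d) / 2) *: (x - y)).
  by apply: (dot_inj hdot) => w; rewrite !dotE; field.
rewrite (le_trans (ler_normD _ _))// (le_trans (lerD hA hB))//.
by rewrite -mulrDl ler_wpM2r//; lra.
Qed.

(** Both factors of the product are multiplied by [c], and the shift by [e] cancels. *)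
Lemma sector_affine a b c (e : R) A : 0 <= c -> sector dot a b A ->
  sector dot (c * a + e) (c * b + e) (fun x => c *: A x + e *: x).
Proof.
move=> c0 sA x y.
have -> : c *: A x + e *: x - (c *: A y + e *: y) - (c * a + e) *: (x - y) =
  c *: (A x - A y - a *: (x - y)).
  by apply: (dot_inj hdot) => w; rewrite !dotE; ring.
have -> : (c * b + e) *: (x - y) - (c *: A x + e *: x - (c *: A y + e *: y)) =
  c *: (b *: (x - y) - (A x - A y)).
  by apply: (dot_inj hdot) => w; rewrite !dotE; ring.
by rewrite dotZl dotZr !mulr_ge0//; exact: sA.
Qed.

Lemma sectorZ a b c A : 0 <= c -> sector dot a b A ->
  sector dot (c * a) (c * b) (c \*: A).
Proof.
move=> c0 /(sector_affine 0 c0); rewrite !addr0.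
suff -> : (fun x => c *: A x + 0 *: x) = c \*: A by [].
by apply/funext => x; rewrite scale0r addr0.
Qed.

Lemma explicit_sector a b A : sector dot a b A ->
  sector dot (1 - b) (1 - a) (explicit_op A).
Proof.
move=> sA x y; rewrite /explicit_op.
have -> : x - A x - (y - A y) - (1 - b) *: (x - y) =
  b *: (x - y) - (A x - A y).
  by apply: (dot_inj hdot) => w; rewrite !dotE; ring.
have -> : (1 - a) *: (x - y) - (x - A x - (y - A y)) =
  A x - A y - a *: (x - y).
  by apply: (dot_inj hdot) => w; rewrite !dotE; ring.
by rewrite dotC; exact: sA.
Qed.

Lemma lipschitz_fixed_point m A : 0 <= m < 1 -> m.-lipschitz A ->
  exists x, x = A x.
Proof.
move=> /andP[m0 m1] lA.
have [|||x _ hx] := @banach_fixed_point R H setT [fun of totalfun A].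
- by exists (NngNum m0).
- exact: closedT.
- by exists 0.
by exists x.
Qed.

(* [y + A y = x] is the fixed point equation of the explicit step
   [y |-> y - k (y + A y - x)], a contraction for [k = 2 / (2 + a + b)]. *)
Lemma resolventK a b A x : 0 <= a <= b -> sector dot a b A ->
  resolvent A x + A (resolvent A x) = x.
Proof.
move=> /andP[a0 ab] sA.
suff [y hy] : exists y, y + A y = x.
  by rewrite /resolvent; case: xgetP => [z _ //|/(_ y)].
have s1 := sector_affine 1 ler01 sA.
pose k := 2 / (2 + a + b).
have k0 : 0 < k by rewrite divr_gt0//; lra.
have s2 := explicit_sector (sectorZ (ltW k0) s1).
(* This makes the two sector bounds of the step, [1 - k (1 + b)] and [1 - k (1 + a)], opposite; the
   contraction factor is [(b - a) / (2 + a + b)]. *)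
have K : k * (2 + a + b) = 2 by rewrite /k divfK// gt_eqF//; lra.
have ka : 0 < k * (1 + a) by rewrite mulr_gt0//; lra.
have kab : k * a <= k * b by rewrite ler_pM2l.
have lA := sector_lipschitz (m := 1 - k * (1 + a)) _ _ _ s2.
have [||y hy] := @lipschitz_fixed_point (1 - k * (1 + a))
  (fun y => explicit_op (k \*: (fun x => 1 *: A x + 1 *: x)) y + k *: x).
- by apply/andP; split; lra.
- have {}lA : (1 - k * (1 + a)).-lipschitz
      (explicit_op (k \*: (fun x => 1 *: A x + 1 *: x))).
    by apply: lA; lra.
  apply/lipschitzP => u v; move/lipschitzP: lA => /(_ u v).
  have addK (p q r : H) : p + r - (q + r) = p - q.
    by rewrite opprD addrACA subrr addr0.
  by rewrite addK.
exists y; apply/eqP; rewrite -subr_eq0.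
have : k *: (y + A y - x) = 0.
  have /eqP := hy; rewrite /explicit_op /= !scale1r -subr_eq0 => /eqP <-.
  by apply: (dot_inj hdot) => w; rewrite !dotE; ring.
by move/eqP; rewrite scaler_eq0 gt_eqF.
Qed.

(** After substituting [x = u + A u], the two factors are those of [A] at [u] and [v], exchanged and
    rescaled. *)
Lemma resolvent_sector a b A : 0 <= a <= b -> sector dot a b A ->
  sector dot (1 + b)^-1 (1 + a)^-1 (resolvent A).
Proof.
move=> ab sA x y.
move: (resolventK x ab sA) (resolventK y ab sA).
move: (resolvent A x) (resolvent A y) => u v <- <-.
have [a1 b1] : 1 + a != 0 /\ 1 + b != 0.
  by case/andP: ab => a0 ab; split; rewrite gt_eqF//; lra.
have -> : u - v - (1 + b)^-1 *: (u + A u - (v + A v)) =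
  (1 + b)^-1 *: (b *: (u - v) - (A u - A v)).
  by apply: (dot_inj hdot) => w; rewrite !dotE; field.
have -> : (1 + a)^-1 *: (u + A u - (v + A v)) - (u - v) =
  (1 + a)^-1 *: (A u - A v - a *: (u - v)).
  by apply: (dot_inj hdot) => w; rewrite !dotE; field.
rewrite dotZl dotZr dotC !mulr_ge0 ?invr_ge0//; case/andP: ab; lra.
Qed.

Lemma reflected_resolvent_sector a b A : 0 <= a <= b -> sector dot a b A ->
  sector dot (2 * (1 + b)^-1 - 1) (2 * (1 + a)^-1 - 1) (reflected_resolvent A).
Proof.
move=> ab sA.
have := sector_affine (- 1) (ltW (ltr0Sn R 1)) (resolvent_sector ab sA).
suff -> : reflected_resolvent A = fun x => 2 *: resolvent A x + - 1 *: x by [].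
by apply/funext => x; rewrite scaleN1r.
Qed.

(** Cauchy-Schwarz on the ball form; centre minus radius is [(a + b) / 2 - (b - a) / 2 = a]. *)
Lemma sector_strong a b A x y : a <= b -> sector dot a b A ->
  a * `|x - y| ^+ 2 <= dot (A x - A y) (x - y).
Proof.
move=> ab sA; have := sA x y; rewrite sector_ball//.
move: (A x - A y) (x - y) => q p hq.
have := dot_le hdot (- (q - ((a + b) / 2) *: p)) p; rewrite normrN => hl.
have := le_trans hl (ler_wpM2r (normr_ge0 p) hq).
rewrite -[_ * `|p| * `|p|]mulrA -expr2 -!hdot !dotE.
by move: (dot p p) (dot q p) => i j; lra.
Qed.

Lemma sector_cocoercive b A x y : sector dot 0 b A ->
  `|A x - A y| ^+ 2 <= b * dot (A x - A y) (x - y).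
Proof.
move=> sA; have := sA x y; rewrite scale0r subr0 -hdot.
by rewrite [dot _ (_ - (A x - A y))]dotDr dotNr dotZr subr_ge0.
Qed.

(** With [s] and [p] the increments of the operator and of its argument, the assumed bound yields
    [(1 + c) |s|^2 <= <s, p> <= |s| |p|]. It is left abstract so as to serve both orders of the
    operators. *)
Lemma douglas_rachford_lipschitz c A B : 0 <= c ->
  (forall x, resolvent A x + A (resolvent A x) = x) ->
  (forall x, resolvent B x + B (resolvent B x) = x) ->
  (forall y y' z z', z + A y = y - B z -> z' + A y' = y' - B z' ->
     c * `|z + A y - (z' + A y')| ^+ 2 <=
     dot (A y - A y') (y - y') + dot (B z - B z') (z - z')) ->
  (1 + c)^-1.-lipschitz (douglas_rachford B A).
Proof.
move=> c0 hA hB hc; apply/lipschitzP => x x'.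
(* Here [y] is the resolvent of [A] at [u], and [z] that of [B] at [2 y - u = y - A y]. *)
have DR u : exists y z, [/\ u = y + A y, z + A y = y - B z &
    douglas_rachford B A u = z + A y].
  rewrite /douglas_rachford /peaceman_rachford /= /reflected_resolvent.
  move: (hA u) (hB (2 *: resolvent A u - u)).
  move: (resolvent B _) => z; move: (resolvent A u) => y <- zy.
  exists y, z; split=> //.
    apply/esym/eqP; rewrite subr_eq addrAC zy.
    by apply/eqP/(dot_inj hdot) => w; rewrite !dotE; ring.
  by apply: (dot_inj hdot) => w; rewrite !dotE; field.
have [y [z [-> yz ->]]] := DR x; have [y' [z' [-> yz' ->]]] := DR x'.
have := hc _ _ _ _ yz yz'.
set s := z + A y - _; set p := y + A y - _.
have -> : dot (A y - A y') (y - y') + dot (B z - B z') (z - z') = dot s (p - s).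
  have Bz : B z = y - (z + A y) by rewrite yz subKr.
  have Bz' : B z' = y' - (z' + A y') by rewrite yz' subKr.
  have -> : p - s = y - y' - (z - z').
    by rewrite /p /s; apply: (dot_inj hdot) => w; rewrite !dotE; ring.
  rewrite /s Bz Bz' !dotE.
  rewrite ?(dotC dot y) ?(dotC dot y') ?(dotC dot z) ?(dotC dot z').
  ring.
rewrite dotDr dotNr hdot => hs.
rewrite ler_pdivlMl ?ltr_wpDr//.
have := dot_le hdot s p.
have [->|s0] := eqVneq s 0; first by rewrite normr0 mulr0.
have ns : 0 < `|s| by rewrite normr_gt0.
move=> hsp; rewrite -(ler_pM2l ns) (le_trans _ hsp)//.
have -> : `|s| * ((1 + c) * `|s|) = `|s| ^+ 2 + c * `|s| ^+ 2 by ring.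
by rewrite -lerBrDl.
Qed.

(** After multiplication by [a + b] the difference of the sides is [|a x - b y|^2]. *)
Lemma weighted_normD a b x y : 0 < a -> 0 < b ->
  a * b / (a + b) * `|x + y| ^+ 2 <= a * `|x| ^+ 2 + b * `|y| ^+ 2.
Proof.
move=> a0 b0; have ab : 0 < a + b by exact: addr_gt0.
rewrite -(ler_pM2l ab) mulrA [(a + b) * (_ / _)]mulrC divfK ?gt_eqF//.
have := sqr_ge0 `|a *: x - b *: y|.
rewrite -!hdot !dotE (dotC dot y x).
by move: (dot x x) (dot x y) (dot y y) => p q r; lra.
Qed.

End sector_operators.

(** * Range and minimization of the rates as functions of the step size *)

Section rate_bounds.
Context {R : realType}.
Implicit Types (x y t : R).

Lemma max_norm_ge x y : x <= Num.max `|x| `|y|.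
Proof. by rewrite le_max ler_norm. Qed.

Lemma max_norm_geN x y : - Num.max `|x| `|y| <= y.
Proof. by rewrite lerNl le_max -(normrN y) ler_norm orbT. Qed.

Lemma max_contraction_lt1 x y t : 0 < x <= y -> 0 < t < 2 / y ->
  Num.max `|1 - t * x| `|1 - t * y| < 1.
Proof.
move=> /andP[x0 xy] /andP[t0]; have y0 := lt_le_trans x0 xy.
rewrite ltr_pdivlMr// => ty.
have tx : 0 < t * x by exact: mulr_gt0.
have txy : t * x <= t * y by rewrite ler_pM2l.
by rewrite gt_max !ltr_norml; apply/andP; split; apply/andP; split; lra.
Qed.

Lemma max_contraction_eq0 x y t :
  Num.max `|1 - t * x| `|1 - t * y| = 0 -> t * x = 1 /\ t * y = 1.
Proof.
move=> h; have : Num.max `|1 - t * x| `|1 - t * y| <= 0 by rewrite h.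
rewrite ge_max !normr_le0 !subr_eq0 => /andP[/eqP <- /eqP <-].
by split.
Qed.

(** The combination [y (1 - t x) + x (t y - 1) = y - x] is independent of [t], which bounds
    [(x + y) r t] from below; at the optimum [1 - t x = t y - 1]. *)
Lemma max_contraction_optimal x y : 0 < x <= y ->
  let r t := Num.max `|1 - t * x| `|1 - t * y| in
  minimizer_on [set` `]0, 2 / y[] r (2 / (x + y)) /\
  r (2 / (x + y)) = (y - x) / (y + x).
Proof.
move=> /andP[x0 xy] r; have y0 := lt_le_trans x0 xy.
have xy0 : 0 < x + y by exact: addr_gt0.
have n1 : x + y != 0 by rewrite gt_eqF.
have n2 : y + x != 0 by rewrite addrC.
have rE : r (2 / (x + y)) = (y - x) / (y + x).
  rewrite /r.
  have -> : 1 - 2 / (x + y) * x = (y - x) / (y + x).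
    by field; rewrite ?n1 ?n2.
  have -> : 1 - 2 / (x + y) * y = - ((y - x) / (y + x)).
    by field; rewrite ?n1 ?n2.
  by rewrite normrN maxxx ger0_norm// divr_ge0 ?subr_ge0// ltW// addrC.
split=> //; split=> [|t _].
  rewrite /= in_itv/= divr_gt0//= ltr_pM2l// ltf_pV2 ?posrE//; lra.
rewrite rE ler_pdivrMr; last by rewrite addrC.
have h1 : 1 - t * x <= r t by rewrite le_max ler_norm.
have h2 : t * y - 1 <= r t by rewrite le_max [`|1 - t * y|]distrC ler_norm orbT.
have := lerD (ler_wpM2l (ltW y0) h1) (ler_wpM2l (ltW x0) h2).
by rewrite -/(r t); move: (r t) => m; lra.
Qed.

(** Expressing everything through the one root [Num.sqrt (x / y)] makes the optimal values rational
    functions of it. *)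
Lemma sqrt_divE x y : 0 < x -> 0 < y ->
  [/\ 0 < Num.sqrt (x / y), x = Num.sqrt (x / y) ^+ 2 * y
    & Num.sqrt (x * y) = Num.sqrt (x / y) * y].
Proof.
move=> x0 y0; have xy0 : 0 < x / y by exact: divr_gt0.
split; first by rewrite sqrtr_gt0.
  by rewrite sqr_sqrtr ?ltW// divfK// gt_eqF.
have ry : x * y = x / y * y ^+ 2 by field; rewrite gt_eqF.
by rewrite ry sqrtrM ?ltW// sqrtr_sqr gtr0_norm.
Qed.

Variables alpha beta rho : R.
Hypotheses (alpha_gt0 : 0 < alpha) (beta_gt0 : 0 < beta) (rho_gt0 : 0 < rho).

(** Here [x] stands for the root of [alpha / rho]. The first fraction of [rR] decreases in [t], the
    second increases, and they meet at [x]. *)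
Lemma rR_ge x : 0 <= x -> forall t, 0 < t ->
  x ^+ 2 * rho = alpha -> (1 - x * rho) / (1 + x * rho) <= rR alpha rho t.
Proof.
move=> x0 t t0 xE; rewrite /rR le_max.
have xr : 0 <= x * rho by rewrite mulr_ge0// ltW.
have tr : 0 < t * rho by exact: mulr_gt0.
have [tx|xt] := leP t x; apply/orP; [left|right].
  have trx : t * rho <= x * rho by rewrite ler_pM2r.
  rewrite ler_pdivrMr; last by lra.
  by rewrite mulrAC ler_pdivlMr; lra.
have ta : 0 < t * alpha^-1 by rewrite mulr_gt0 ?invr_gt0.
have h : 1 <= t * alpha^-1 * (x * rho).
  rewrite mulrAC ler_pdivlMr// mul1r -xE expr2 -mulrA ler_wpM2r//.
  exact: ltW.
rewrite ler_pdivrMr; last by lra.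
by rewrite mulrAC ler_pdivlMr; lra.
Qed.

Lemma rR_sqrt : rR alpha rho (Num.sqrt (alpha / rho)) =
  (1 - Num.sqrt (alpha * rho)) / (1 + Num.sqrt (alpha * rho)).
Proof.
have [s0 aE ->] := sqrt_divE alpha_gt0 rho_gt0; move: s0 aE.
move: (Num.sqrt _) => s s0 aE; rewrite /rR aE.
have sr : 0 < s * rho by exact: mulr_gt0.
rewrite (_ : (s * (s ^+ 2 * rho)^-1 - 1) / (s * (s ^+ 2 * rho)^-1 + 1) =
  (1 - s * rho) / (1 + s * rho)) ?maxxx//.
have n1 : s != 0 by rewrite gt_eqF.
have n2 : rho != 0 by rewrite gt_eqF.
have n3 : 1 + s * rho != 0 by rewrite gt_eqF// ltr_wpDr ?ltW.
by field; rewrite ?n1 ?n2 ?n3.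
Qed.

(* With [a = t rho] and [g = beta / t] this is [1 / (1 + a g / (a + g))]. *)
Definition dr_rate (t : R) :=
  (beta + t ^+ 2 * rho) / (beta + t * beta * rho + t ^+ 2 * rho).

(** With [beta = s^2 rho], cross-multiplication leaves the difference [(s - t)^2 s rho^2]. *)
Lemma dr_rate_ge t : 0 < t ->
  2 / (2 + Num.sqrt (beta * rho)) <= dr_rate t.
Proof.
have [s0 bE ->] := sqrt_divE beta_gt0 rho_gt0; move: s0 bE.
move: (Num.sqrt _) => s s0 bE t0; rewrite /dr_rate bE.
have sr : 0 < s * rho by exact: mulr_gt0.
have ? : 0 < s ^+ 2 * rho by rewrite mulr_gt0 ?exprn_gt0.
have ? : 0 < t * (s ^+ 2 * rho) * rho by rewrite !mulr_gt0 ?exprn_gt0.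
have ? : 0 < t ^+ 2 * rho by rewrite mulr_gt0 ?exprn_gt0.
rewrite ler_pdivrMr; last by lra.
rewrite mulrAC ler_pdivlMr; last by lra.
have : 0 <= (s - t) ^+ 2 * (s * rho * rho) by rewrite mulr_ge0 ?sqr_ge0 ?mulr_ge0 ?ltW.
lra.
Qed.

Lemma dr_rate_sqrt : dr_rate (Num.sqrt (beta / rho)) =
  2 / (2 + Num.sqrt (beta * rho)).
Proof.
have [s0 bE ->] := sqrt_divE beta_gt0 rho_gt0; move: s0 bE.
move: (Num.sqrt _) => s s0 bE; rewrite /dr_rate bE.
have n1 : s != 0 by rewrite gt_eqF.
have n2 : rho != 0 by rewrite gt_eqF.
have n3 : 2 + s * rho != 0 by rewrite gt_eqF// ltr_wpDr ?mulr_ge0 ?ltW.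
have n4 : s ^+ 2 * rho + s * (s ^+ 2 * rho) * rho + s ^+ 2 * rho != 0.
  rewrite (_ : _ + _ = s ^+ 2 * rho * (2 + s * rho)); last by ring.
  by rewrite !mulf_neq0.
apply/eqP; rewrite eqr_div//; apply/eqP; ring.
Qed.

Lemma rR_itv t : rho <= alpha^-1 -> 0 < t -> 0 <= rR alpha rho t < 1.
Proof.
move=> ra t0; rewrite /rR.
have tr : 0 < t * rho by exact: mulr_gt0.
have : t * rho <= t * alpha^-1 by rewrite ler_pM2l.
move: (t * rho) (t * alpha^-1) tr => a b a0 ab.
rewrite le_max gt_max !ltr_pdivrMr ?mul1r; [|lra|lra].
apply/andP; split; last by apply/andP; split; lra.
have [a1|a1] := leP a 1; apply/orP; [left|right].
  by rewrite divr_ge0//; lra.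
by rewrite divr_ge0//; lra.
Qed.

(** The one degenerate case, in which the rate is [0] and the interval must be closed on the
    left. *)
Lemma rR_eq0 t : rho <= alpha^-1 -> 0 < t ->
  rR alpha rho t = 0 <-> rho = alpha^-1 /\ t = alpha.
Proof.
move=> ra t0.
have tr : 0 < t * rho by exact: mulr_gt0.
have tra : t * rho <= t * alpha^-1 by rewrite ler_pM2l.
split=> [r0|[-> ->]].
  have : rR alpha rho t <= 0 by rewrite r0.
  rewrite /rR ge_max !ler_pdivrMr ?mul0r; [|lra|lra].
  move=> /andP[h1 h2].
  have ta1 : t * alpha^-1 = 1 by lra.
  have tr1 : t * rho = 1 by lra.
  split; first by apply: (mulfI (lt0r_neq0 t0)); rewrite tr1 ta1.
  by rewrite -[LHS](divfK (lt0r_neq0 alpha_gt0)) ta1 mul1r.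
by rewrite /rR divff ?gt_eqF// subrr !mul0r maxxx.
Qed.

Lemma rS_itv t : rho <= alpha^-1 -> 0 < t -> 0 < rS alpha beta rho t < 1.
Proof.
move=> ra t0; rewrite /rS lt_min gt_min.
have /andP[r0 r1] := rR_itv ra t0.
apply/andP; split; last by apply/orP; left; rewrite ltr_pdivrMr//; lra.
apply/andP; split; first by rewrite divr_gt0//; lra.
by rewrite divr_gt0 ?addr_gt0 ?mulr_gt0 ?exprn_gt0.
Qed.

(** A pointwise minimum of two functions is minimized where the one with the smaller minimum is, so
    only the two optimal values are to be compared. *)
Lemma rS_optimal :
  let opt := if beta <= 4 * alpha
             then (Num.sqrt (alpha / rho), 1 / (1 + Num.sqrt (alpha * rho)))
             else (Num.sqrt (beta / rho), 2 / (2 + Num.sqrt (beta * rho))) in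
  minimizer_on [set` `]0, +oo[] (rS alpha beta rho) opt.1 /\
  rS alpha beta rho opt.1 = opt.2.
Proof.
have [s0 aE sE] := sqrt_divE alpha_gt0 rho_gt0.
have [q0 bE qE] := sqrt_divE beta_gt0 rho_gt0.
have := rR_sqrt; have := dr_rate_sqrt; have := dr_rate_ge.
have := @rR_ge _ (ltW s0); rewrite -aE sE qE.
set s := Num.sqrt (alpha / rho) in s0 aE sE *.
set q := Num.sqrt (beta / rho) in q0 bE qE *.
move=> Rge Dge Dq Rs.
have sr : 0 < s * rho by exact: mulr_gt0.
have qr : 0 < q * rho by exact: mulr_gt0.
have RE : (1 + (1 - s * rho) / (1 + s * rho)) / 2 = 1 / (1 + s * rho).
  by field; rewrite gt_eqF//; lra.
have {}Rge t : 0 < t -> 1 / (1 + s * rho) <= (1 + rR alpha rho t) / 2.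
  by move=> t0; rewrite -RE ler_pM2r// lerD2l; exact: Rge.
(* With [alpha = s^2 rho] and [beta = q^2 rho], the comparison reduces to [q <= 2 s], whose square
   is the threshold. *)
have cmp : (1 / (1 + s * rho) <= 2 / (2 + q * rho)) = (beta <= 4 * alpha).
  rewrite ler_pdivrMr; last by lra.
  rewrite mulrAC ler_pdivlMr; last by lra.
  rewrite (_ : (_ <= _) = (q * rho <= 2 * s * rho)); last by apply/idP/idP; lra.
  rewrite ler_pM2r// [in RHS]bE [in RHS]aE mulrA ler_pM2r//.
  have s2 : 0 <= 2 * s by lra.
  rewrite -[LHS](ler_pXn2r (n := 2)) ?nnegrE ?(ltW q0)//.
  by rewrite exprMn -natrX.
case: ifP cmp => ab cmp /=.
  have E : rS alpha beta rho s = 1 / (1 + s * rho).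
    rewrite /rS -/(dr_rate _) Rs RE; apply/min_idPl.
    exact: le_trans cmp (Dge _ s0).
  split=> //; split=> [|t]; first by rewrite /= in_itv/= s0.
  rewrite /= in_itv/= andbT => t0; rewrite E /rS le_min Rge//=.
  exact: le_trans cmp (Dge _ t0).
have {}cmp : 2 / (2 + q * rho) <= 1 / (1 + s * rho).
  by rewrite ltW// ltNge cmp.
have E : rS alpha beta rho q = 2 / (2 + q * rho).
  rewrite /rS -/(dr_rate _) Dq; apply/min_idPr.
  exact: le_trans cmp (Rge _ q0).
split=> //; split=> [|t]; first by rewrite /= in_itv/= q0.
rewrite /= in_itv/= andbT => t0; rewrite E /rS le_min -/(dr_rate _) Dge// andbT.
exact: le_trans cmp (Rge _ t0).
Qed.

End rate_bounds.

(** * Lipschitz constants and optimal step sizes of the five kinds of operators *)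

Theorem proposition5 (R : realType) (H : completeNormedModType R)
    (dot : {dot H for (@idfun R)}) (hdot : inner_product dot)
    (alpha beta rho : R) (alpha_gt0 : 0 < alpha) (beta_gt0 : 0 < beta)
    (hrho : rho \in `]0, alpha^-1])
    (f g : H -> R)
    (fC11 : C11 dot alpha^-1 f) (fsc : strongly_convex rho f)
    (gC11 : C11 dot beta^-1 g) (gconv : convex g)
    (hmin : exists z : H, minimizer_on setT (f \+ g) z)
    (tau : R) (tau_gt0 : 0 < tau) :
  let df := grad dot f in
  let dg := grad dot g in
  [/\ (* 1 *)
      (tau \in `]0, 2 * beta * alpha / (beta + alpha)[ ->
         (rG alpha beta rho tau).-lipschitz
           (explicit_op (tau \*: (dg \+ df)))
         /\ rG alpha beta rho tau \in `]0, 1[)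
      /\ (let ts := 2 / (rho + alpha^-1 + beta^-1) in
          minimizer_on [set` `]0, 2 * beta * alpha / (beta + alpha)[]
            (rG alpha beta rho) ts
          /\ rG alpha beta rho ts
             = (alpha^-1 + beta^-1 - rho) / (alpha^-1 + beta^-1 + rho)),
      (* 2 *)
      (tau \in `]0, 2 * alpha[ ->
         [/\ (rT1 alpha rho tau).-lipschitz
               (forward_backward (tau \*: dg) (tau \*: df)),
             rT1 alpha rho tau \in `[0, 1[
           & rT1 alpha rho tau = 0 <-> rho = alpha^-1 /\ tau = alpha])
      /\ (let ts := 2 / (rho + alpha^-1) in
          minimizer_on [set` `]0, 2 * alpha[] (rT1 alpha rho) ts
          /\ rT1 alpha rho ts = (alpha^-1 - rho) / (alpha^-1 + rho)),
      (* 3 *)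
      (tau \in `]0, 2 * beta] ->
         (rT2 rho tau).-lipschitz
           (forward_backward (tau \*: df) (tau \*: dg))
         /\ rT2 rho tau \in `]0, 1[)
      /\ (minimizer_on [set` `]0, 2 * beta]] (rT2 rho) (2 * beta)
          /\ rT2 rho (2 * beta) = 1 / (1 + 2 * beta * rho)),
      (* 4 *)
      [/\ (rR alpha rho tau).-lipschitz
            (peaceman_rachford (tau \*: dg) (tau \*: df)),
          (rR alpha rho tau).-lipschitz
            (peaceman_rachford (tau \*: df) (tau \*: dg)),
          rR alpha rho tau \in `[0, 1[
        & rR alpha rho tau = 0 <-> rho = alpha^-1 /\ tau = alpha]
      /\ (let ts := Num.sqrt (alpha / rho) in
          minimizer_on [set` `]0, +oo[] (rR alpha rho) ts
          /\ rR alpha rho ts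
             = (1 - Num.sqrt (alpha * rho)) / (1 + Num.sqrt (alpha * rho)))
    & (* 5 *)
      [/\ (rS alpha beta rho tau).-lipschitz
            (douglas_rachford (tau \*: dg) (tau \*: df)),
          (rS alpha beta rho tau).-lipschitz
            (douglas_rachford (tau \*: df) (tau \*: dg))
        & rS alpha beta rho tau \in `]0, 1[]
      /\ (let opt := if beta <= 4 * alpha
                     then (Num.sqrt (alpha / rho),
                           1 / (1 + Num.sqrt (alpha * rho)))
                     else (Num.sqrt (beta / rho),
                           2 / (2 + Num.sqrt (beta * rho))) in
          minimizer_on [set` `]0, +oo[] (rS alpha beta rho) opt.1
          /\ rS alpha beta rho opt.1 = opt.2)].
Proof.
move=> df dg.
have /andP[rho0 ra] : 0 < rho <= alpha^-1 by move: hrho; rewrite in_itv.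
have a0 : 0 < alpha^-1 by rewrite invr_gt0.
have b0 : 0 < beta^-1 by rewrite invr_gt0.
have sf : sector dot rho alpha^-1 df by exact: (sector_grad hdot).
have sg : sector dot 0 beta^-1 dg.
  apply: (sector_grad hdot) => //; first exact: ltW.
  (* Convexity is strong convexity with modulus [0]. *)
  rewrite /strongly_convex (_ : (fun x => _) = g)//.
  by apply/funext => x; rewrite !mul0r subr0.
have stf := sectorZ hdot (ltW tau_gt0) sf.
have stg := sectorZ hdot (ltW tau_gt0) sg; rewrite mulr0 in stg.
have tr0 : 0 < tau * rho by exact: mulr_gt0.
have tb0 : 0 < tau * beta^-1 by exact: mulr_gt0.
have tra : tau * rho <= tau * alpha^-1 by rewrite ler_pM2l.
have ordf : 0 <= tau * rho <= tau * alpha^-1 by rewrite ltW.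
have ordg : (0 : R) <= 0 <= tau * beta^-1 by rewrite lexx ltW.
have Jf_lip : (rT2 rho tau).-lipschitz (resolvent (tau \*: df)).
  have := resolvent_sector hdot ordf stf.
  apply: (sector_lipschitz hdot); rewrite /rT2 ?div1r//.
    by rewrite lef_pV2 ?posrE; lra.
  have : 0 <= (1 + tau * alpha^-1)^-1 by rewrite invr_ge0; lra.
  have : 0 <= (1 + tau * rho)^-1 by rewrite invr_ge0; lra.
  lra.
have Jg_lip : 1.-lipschitz (resolvent (tau \*: dg)).
  have := resolvent_sector hdot ordg stg; rewrite addr0 invr1.
  have : 0 <= (1 + tau * beta^-1)^-1 by rewrite invr_ge0; lra.
  have : (1 + tau * beta^-1)^-1 <= 1 by rewrite invf_le1; lra.
  by move=> h1 h2; apply: (sector_lipschitz hdot); lra.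
have Rf_lip : (rR alpha rho tau).-lipschitz (reflected_resolvent (tau \*: df)).
  have := reflected_resolvent_sector hdot ordf stf.
  apply: (sector_lipschitz hdot).
  - by rewrite lerD2r ler_pM2l// lef_pV2 ?posrE; lra.
  - rewrite lerNl /rR le_max; apply/orP; right.
    by rewrite le_eqVlt; apply/orP; left; apply/eqP; field; rewrite ?gt_eqF//; lra.
  - rewrite /rR le_max; apply/orP; left.
    by rewrite le_eqVlt; apply/orP; left; apply/eqP; field; rewrite ?gt_eqF//; lra.
have Rg_lip : 1.-lipschitz (reflected_resolvent (tau \*: dg)).
  have := reflected_resolvent_sector hdot ordg stg; rewrite addr0 invr1 mulr1.
  have : 0 <= (1 + tau * beta^-1)^-1 by rewrite invr_ge0; lra.
  have : (1 + tau * beta^-1)^-1 <= 1 by rewrite invf_le1; lra.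
  by move=> h1 h2; apply: (sector_lipschitz hdot); lra.
have /andP[rR0 rR1] := rR_itv rho0 ra tau_gt0.
have Rgf : (rR alpha rho tau).-lipschitz
    (peaceman_rachford (tau \*: dg) (tau \*: df)).
  by have := lipschitz_comp ler01 Rg_lip Rf_lip; rewrite mul1r.
have Rfg : (rR alpha rho tau).-lipschitz
    (peaceman_rachford (tau \*: df) (tau \*: dg)).
  by have := lipschitz_comp rR0 Rf_lip Rg_lip; rewrite mulr1.
split.
- have LE : 2 * beta * alpha / (beta + alpha) = 2 / (beta^-1 + alpha^-1).
    by field; rewrite ?gt_eqF//; lra.
  have ord : 0 < rho <= beta^-1 + alpha^-1 by rewrite rho0/=; lra.
  rewrite LE; split.
    rewrite in_itv/= => t2; have lt1 := max_contraction_lt1 ord t2.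
    split; last first.
      rewrite in_itv/= lt1 andbT lt_neqAle eq_sym le_max normr_ge0/= andbT.
      (* A zero rate would give [tau rho = tau / beta + tau / alpha], contradicting
         [rho <= 1 / alpha]. *)
      apply/eqP => /max_contraction_eq0[h1 h2].
      have := mulr_gt0 tau_gt0 b0; nra.
    have := sectorZ hdot (ltW tau_gt0) (sectorD hdot (ltW b0) ra sg sf).
    rewrite add0r => /(explicit_sector hdot).
    apply: (sector_lipschitz hdot); rewrite /rG.
    + by rewrite lerD2l lerN2 ler_pM2l//; lra.
    + exact: max_norm_geN.
    + exact: max_norm_ge.
  rewrite -(addrA rho) [alpha^-1 + beta^-1]addrC.
  exact: max_contraction_optimal ord.
- split=> [t2|].
    have {}t2 : 0 < tau < 2 / alpha^-1 by move: t2; rewrite in_itv invrK.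
    have lt1 := max_contraction_lt1 (introT andP (conj rho0 ra)) t2.
    split.
    + have Gf : (rT1 alpha rho tau).-lipschitz (explicit_op (tau \*: df)).
        apply: (sector_lipschitz hdot) (explicit_sector hdot stf).
        * by lra.
        * exact: max_norm_geN.
        * exact: max_norm_ge.
      by have := lipschitz_comp ler01 Jg_lip Gf; rewrite mul1r.
    + by rewrite in_itv/= lt1 andbT le_max normr_ge0.
    + split=> [/max_contraction_eq0[h1 h2]|[-> ->]].
        split; first by apply: (mulfI (lt0r_neq0 tau_gt0)); rewrite h1 h2.
        by rewrite -[LHS](divfK (lt0r_neq0 alpha_gt0)) h2 mul1r.
      by rewrite /rT1 divff ?gt_eqF// subrr normr0 maxxx.
  have /= := max_contraction_optimal (introT andP (conj rho0 ra)).
  by rewrite invrK.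
- split=> [|].
    rewrite in_itv/= => /andP[_ t2]; split.
      (* The bounds [1 - tau / beta] and [1] lie in [[-1, 1]] because [tau <= 2 beta]. *)
      have Gg : 1.-lipschitz (explicit_op (tau \*: dg)).
        have : tau * beta^-1 <= 2 by rewrite ler_pdivrMr.
        by move=> tb2; apply: (sector_lipschitz hdot) (explicit_sector hdot stg); lra.
      have T0 : 0 <= rT2 rho tau by rewrite /rT2 divr_ge0//; lra.
      by have := lipschitz_comp T0 Jf_lip Gg; rewrite mulr1.
    rewrite in_itv/= /rT2 divr_gt0//=; last by lra.
    by rewrite ltr_pdivrMr; lra.
  split=> //; split=> [|t]; rewrite /= in_itv/= ?lexx ?mulr_gt0//.
  move=> /andP[t0 t2]; rewrite /rT2 !div1r.
  have tr : 0 < t * rho by exact: mulr_gt0.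
  have tbr : t * rho <= 2 * beta * rho by rewrite ler_pM2r.
  by rewrite lef_pV2 ?posrE; lra.
- split; first split=> //.
  + by rewrite in_itv/= rR0 rR1.
  + exact: (rR_eq0 alpha_gt0).
  have [s0 aE sE] := sqrt_divE alpha_gt0 rho0.
  have RE := rR_sqrt alpha_gt0 rho0.
  split=> //; split=> [|t]; first by rewrite /= in_itv/= s0.
  rewrite /= in_itv/= andbT => t0; rewrite RE sE.
  by apply: rR_ge => //; exact: ltW.
- split; last exact: rS_optimal.
  (* Combines the strong monotonicity modulus [tau rho] of [tau \*: df] with the cocoercivity
     constant [beta / tau] of [tau \*: dg], as in [weighted_normD]. *)
  pose c := tau * rho * (beta / tau) / (tau * rho + beta / tau).
  have bt0 : 0 < beta / tau by exact: divr_gt0.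
  have c1 : (beta + tau ^+ 2 * rho) / (beta + tau * beta * rho + tau ^+ 2 * rho)
    = (1 + c)^-1.
    by rewrite /c; field; rewrite !gt_eqF ?addr_gt0 ?mulr_gt0 ?exprn_gt0.
  have c0 : 0 <= c.
    by apply/ltW/divr_gt0; [exact: mulr_gt0|exact: addr_gt0].
  have mf y y' := sector_strong hdot y y' tra stf.
  have mg y y' : beta / tau * `|(tau \*: dg) y - (tau \*: dg) y'| ^+ 2 <=
      dot ((tau \*: dg) y - (tau \*: dg) y') (y - y').
    have := ler_wpM2l (ltW bt0) (sector_cocoercive hdot y y' stg).
    have K : beta / tau * (tau * beta^-1) = 1 by field; rewrite !gt_eqF.
    by rewrite [leRHS]mulrA K mul1r.
  have Jf x := resolventK hdot x ordf stf.
  have Jg x := resolventK hdot x ordg stg.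
  have minlip (T : H -> H) : ((1 + rR alpha rho tau) / 2).-lipschitz T ->
      (1 + c)^-1.-lipschitz T -> (rS alpha beta rho tau).-lipschitz T.
    by move=> h1 h2; rewrite /rS c1; case: leP.
  split.
  + apply: (minlip _ (douglas_rachford_average Rgf)).
    apply: (douglas_rachford_lipschitz hdot) => // y y' z z' e e'.
    (* The form [y - B z] involves the strongly monotone operator through [y] and the cocoercive one
       through [B z]. *)
    rewrite e e'.
    have subACA (p q r s : H) : p - q - (r - s) = p - r + - (q - s).
      by rewrite !opprB addrACA [RHS]addrACA [- q - r]addrC.
    rewrite subACA.
    apply: le_trans (weighted_normD hdot _ _ tr0 bt0) _.
    by rewrite normrN; apply: lerD.
  + apply: (minlip _ (douglas_rachford_average Rfg)).
    apply: (douglas_rachford_lipschitz hdot) => // y y' z z' e e'.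
    (* With the operators exchanged, the form [z + A y] is the suitable one. *)
    rewrite opprD addrACA [leRHS]addrC.
    apply: le_trans (weighted_normD hdot _ _ tr0 bt0) _.
    exact: lerD.
  + exact: rS_itv.
Qed.
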